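(* Let $(\mathcal{M},\Psi,A)$ be a quantum graph. Then, as linear maps on the vector space $\mathcal{M}$, $$\mathcal{K}_L=\zeta^{-1}\circ\nabla_A\circ\sigma_{-i/2},$$ where $\mathcal{K}_L$ is the left incidence operator, $\nabla_A$ is the Matsuda incidence operator and $\zeta$ is the canonical bijection $B(L^2(\mathcal{M},\Psi))\to\mathcal{M}\otimes\mathcal{M}$.
   Context: All $C^*$-algebras are finite-dimensional and unital. For a $C^*$-algebra $\mathcal{M}$ and a faithful positive functional $\Psi$ on $\mathcal{M}$, $L^2(\mathcal{M},\Psi)$ is the vector space $\mathcal{M}$ with inner product $\langle a,b\rangle_\Psi=\Psi(a^*b)$. The multiplication $m:L^2(\mathcal{M},\Psi)\otimes L^2(\mathcal{M},\Psi)\to L^2(\mathcal{M},\Psi)$, $m(a\otimes b)=ab$, has Hilbert space adjoint $m^\dagger$. $(\mathcal{M},\Psi)$ is a quantum system with parameter $\delta>0$ if $mm^\dagger=\delta^2\,\mathrm{id}$. Modular group: writing $\Psi(a)=\mathrm{Tr}(\rho a)$ with $\rho\in\mathcal{M}$ positive and invertible and $\mathrm{Tr}$ a faithful trace on $\mathcal{M}$, set $\sigma_z(a)=\rho^{iz}a\rho^{-iz}$ for $z\in\mathbb{C}$; it satisfies $\Psi(ab)=\Psi(b\,\sigma_{-i}(a))$. A quantum graph is a triple $(\mathcal{M},\Psi,A)$ where $(\mathcal{M},\Psi)$ is a quantum system with parameter $\delta$ and $A\in B(L^2(\mathcal{M},\Psi))$ satisfies $m(A\otimes A)m^\dagger=\delta^2A$,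 $A(x)^*=A(x^* )$ and $A^\dagger(x)^*=A^\dagger(x^* )$ for all $x$, where $\dagger$ is the adjoint on $L^2(\mathcal{M},\Psi)$. The opposite algebra $\mathcal{M}^{\mathrm{op}}$ has the same underlying vector space as $\mathcal{M}$, and $\pi^{\mathrm{op}}(a)b=b\,\sigma_{-i/2}(a)$ for $a\in\mathcal{M}^{\mathrm{op}}$, $b\in L^2(\mathcal{M},\Psi)$. The left incidence operator is $\mathcal{K}_L(a)=\delta^{-2}(\pi^{\mathrm{op}}(a)A-A\pi^{\mathrm{op}}(a))\in B(L^2(\mathcal{M},\Psi))$. The Matsuda incidence operator $\nabla_A:\mathcal{M}\to\mathcal{M}\otimes\mathcal{M}$ is $\nabla_A(x)=\delta^{-2}(A^\dagger\otimes\mathrm{id}-\mathrm{id}\otimes A)m^\dagger(x)$. The linear map $\zeta:B(L^2(\mathcal{M},\Psi))\to\mathcal{M}\otimes\mathcal{M}$ is $\zeta(T)=(\mathrm{id}\otimes T)m^\dagger(1)$, with $1$ the unit of $\mathcal{M}$; it is bijective, with $\zeta^{-1}(y\otimes x)=|x\rangle\langle\sigma_{-i}(y^* )|$, where $|a\rangle\langle b|$ denotes the operator $c\mapsto\langle b,c\rangle_\Psi\, a$. *)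

(* Defs.v *)
From HB Require Import structures.
From mathcomp Require Import all_boot all_order all_algebra all_field.
From mathcomp Require Import finmap.
From mathcomp Require Import boolp classical_sets functions cardinality reals.
From mathcomp Require Import topology normedtype sequences exp trigo.
From mathcomp Require Import complex.
From mathcomp Require Import ring.

Set Implicit Arguments.
Unset Strict Implicit.
Unset Printing Implicit Defensive.

Import Order.TTheory GRing.Theory Num.Theory.
Local Open Scope classical_set_scope.
Local Open Scope ring_scope.

Section Tensor.
Variable C : numClosedFieldType.

Definition vbase (V : vectType C) (i : 'I_(\dim {: V})) : V :=
  (vbasis {: V})`_i.

(* V (x) W is modelled by the matrices of coordinates in v_i (x) w_j, where   *)
(* v_i and w_j are the canonical bases; tliftE and tensor_homP give its       *)
(* universal property.                                                        *)
Definition tensor (V W : vectType C) := 'M[C]_(\dim {: V}, \dim {: W}).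

Definition tens (V W : vectType C) (v : V) (w : W) : tensor V W :=
  \matrix_(i, j) (coord (vbasis {: V}) i v * coord (vbasis {: W}) j w).

Definition tlift_fun (V W U : vectType C) (g : V -> W -> U) (X : tensor V W) :
  U := \sum_i \sum_j X i j *: g (vbase i) (vbase j).

Fact tlift_fun_is_linear (V W U : vectType C) (g : V -> W -> U) :
  linear (tlift_fun g).
Proof.
move=> a X Y; rewrite /tlift_fun scaler_sumr -big_split; apply: eq_bigr => i _.
rewrite scaler_sumr -big_split; apply: eq_bigr => j _.
by rewrite !mxE scalerDl scalerA.
Qed.
HB.instance Definition _ (V W U : vectType C) (g : V -> W -> U) :=
  GRing.isSemilinear.Build C (tensor V W) U _ (tlift_fun g)
    (GRing.semilinear_linear (tlift_fun_is_linear g)).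

Definition tlift (V W U : vectType C) (g : V -> W -> U) :
  'Hom(tensor V W, U) := linfun (tlift_fun g).

Definition tmap (V W V' W' : vectType C) (f : 'Hom(V, V')) (g : 'Hom(W, W')) :
  'Hom(tensor V W, tensor V' W') := tlift (fun v w => tens (f v) (g w)).

Lemma tens_is_bilinear (V W : vectType C) :
  (forall v : V, linear (@tens V W v)) /\
  (forall w : W, linear ((@tens V W)^~ w)).
Proof.
split=> [v|w] a x y; apply/matrixP => i j; rewrite !mxE linearP /=; ring.
Qed.

Lemma tensor_base (V W : vectType C) (X : tensor V W) :
  X = \sum_i \sum_j X i j *: tens (vbase i) (vbase j).
Proof.
apply/matrixP => k l.
have fV := basis_free (vbasisP {: V}); have fW := basis_free (vbasisP {: W}).
rewrite summxE (bigD1 k) //= summxE (bigD1 l) //= !big1 ?addr0.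
- by rewrite !mxE !coord_free // !eqxx !mulr1.
- move=> i /negPf ik; rewrite summxE big1 // => j _.
  rewrite !mxE !coord_free //. by rewrite ik mul0r mulr0.
move=> j /negPf jl; by rewrite !mxE !coord_free // jl !mulr0.
Qed.

Lemma tensor_homP (V W U : vectType C) (f g : 'Hom(tensor V W, U)) :
  (forall v w, f (tens v w) = g (tens v w)) -> f = g.
Proof.
move=> fg; apply/lfunP => X; rewrite (tensor_base X) !linear_sum /=.
by apply: eq_bigr => i _; rewrite !linear_sum; apply: eq_bigr => j _ /=;
   rewrite !linearZ /= fg.
Qed.

Lemma linear_sumZ (V U : vectType C) (f : V -> U) (I : Type) (r : seq I)
    (c : I -> C) (x : I -> V) : linear f ->
  f (\sum_(i <- r) c i *: x i) = \sum_(i <- r) c i *: f (x i).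
Proof.
move=> fl; have f0 : f 0 = 0.
  by apply: (addrI (f 0)); rewrite -{1}[f 0]scale1r -fl scaler0 !addr0.
elim: r => [|i r IHr]; first by rewrite !big_nil f0.
by rewrite !big_cons fl IHr.
Qed.

Lemma tliftE (V W U : vectType C) (g : V -> W -> U) (v : V) (w : W) :
  (forall x, linear (g x)) -> (forall y, linear (g ^~ y)) ->
  tlift g (tens v w) = g v w.
Proof.
move=> gr gl; rewrite lfunE /= /tlift_fun.
rewrite [in RHS](coord_vbasis (memvf v)) (linear_sumZ _ _ _ (gl w)).
apply: eq_bigr => i _.
rewrite [in RHS](coord_vbasis (memvf w)) (linear_sumZ _ _ _ (gr _)) scaler_sumr.
by apply: eq_bigr => j _; rewrite scalerA mxE.
Qed.

Lemma tmapE (V W V' W' : vectType C) (f : 'Hom(V, V')) (g : 'Hom(W, W')) v w :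
  tmap f g (tens v w) = tens (f v) (g w).
Proof.
have [tr tl] := tens_is_bilinear V' W'.
by rewrite tliftE // => x a y z; rewrite linearP ?tr ?tl.
Qed.

(* Inner products are conjugate-linear in the first variable; tensor_ip is    *)
(* the sesquilinear form with <a (x) b, c (x) d> = <a, c> <b, d>, see         *)
(* tensor_ip_tens.                                                            *)
Definition tensor_ip (V W : vectType C) (ipV : V -> V -> C) (ipW : W -> W -> C)
    (X Y : tensor V W) : C :=
  \sum_i \sum_j \sum_k \sum_l
     (X i j)^* * Y k l * (ipV (vbase i) (vbase k) * ipW (vbase j) (vbase l)).

Definition hermitian_form (V : vectType C) (ip : V -> V -> C) : Prop :=
  (forall x, linear_for *%R (ip x)) /\ (forall x y, ip y x = (ip x y)^*).

Definition nondegenerate_form (V : vectType C) (ip : V -> V -> C) : Prop :=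
  forall y, (forall x, ip x y = 0) -> y = 0.

(* When ipV and ipW are hermitian and ipV is nondegenerate, the set below is  *)
(* a singleton (adjointP, adjoint_uniq), and xget returns its element.        *)
Definition adjoint (V W : vectType C) (ipV : V -> V -> C) (ipW : W -> W -> C)
    (f : 'Hom(V, W)) : 'Hom(W, V) :=
  xget 0 [set g : 'Hom(W, V) | forall v w, ipV (g w) v = ipW w (f v)].

Section AdjointTheory.
Variables (V W : vectType C) (ipV : V -> V -> C) (ipW : W -> W -> C).
Hypotheses (hV : hermitian_form ipV) (hW : hermitian_form ipW).

Lemma herm_sumr (U : vectType C) (ip : U -> U -> C) (x : U) (I : Type)
    (r : seq I) (c : I -> C) (y : I -> U) : hermitian_form ip ->
  ip x (\sum_(i <- r) c i *: y i) = \sum_(i <- r) c i * ip x (y i).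
Proof. by case=> /(_ x) xl _; apply: (linear_sumZ (U := C^o) _ _ _ xl). Qed.

Lemma herm_suml (U : vectType C) (ip : U -> U -> C) (y : U) (I : Type)
    (r : seq I) (c : I -> C) (x : I -> U) : hermitian_form ip ->
  ip (\sum_(i <- r) c i *: x i) y = \sum_(i <- r) (c i)^* * ip (x i) y.
Proof.
move=> h; rewrite (h.2 y) (herm_sumr _ _ _ _ h) rmorph_sum.
by apply: eq_bigr => i _; rewrite rmorphM /= -h.2.
Qed.

Lemma tensor_ip_tens a b c d :
  tensor_ip ipV ipW (tens a b) (tens c d) = ipV a c * ipW b d.
Proof.
rewrite [in RHS](coord_vbasis (memvf a)) [in RHS](coord_vbasis (memvf b)).
rewrite [in RHS](coord_vbasis (memvf c)) [in RHS](coord_vbasis (memvf d)).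
rewrite !(herm_suml _ _ _ _ hV) !(herm_suml _ _ _ _ hW) big_distrlr /=.
apply: eq_bigr => i _; apply: eq_bigr => j _.
rewrite !(herm_sumr _ _ _ _ hV) !(herm_sumr _ _ _ _ hW).
rewrite mulrACA big_distrlr /= mulr_sumr; apply: eq_bigr => k _.
rewrite mulr_sumr; apply: eq_bigr => l _.
by rewrite !mxE rmorphM /vbase /=; ring.
Qed.

Lemma sum4_exchange (I J K L : finType) (F : I -> J -> K -> L -> C) :
  \sum_i \sum_j \sum_k \sum_l F i j k l = \sum_k \sum_l \sum_i \sum_j F i j k l.
Proof.
have E (I1 J1 K1 L1 : finType) (G : I1 -> J1 -> K1 -> L1 -> C) :
    \sum_i \sum_j \sum_k \sum_l G i j k l
    = \sum_(p : I1 * J1) \sum_(q : K1 * L1) G p.1 p.2 q.1 q.2.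
  by rewrite pair_bigA; apply: eq_bigr => p _; rewrite pair_bigA.
by rewrite E (E _ _ _ _ (fun k l i j => F i j k l)) exchange_big.
Qed.

Lemma tensor_ip_hermitian : hermitian_form (tensor_ip ipV ipW).
Proof.
split=> [X a Y Z|X Y]; rewrite /tensor_ip.
  rewrite mulr_sumr -big_split; apply: eq_bigr => i _ /=.
  rewrite mulr_sumr -big_split; apply: eq_bigr => j _ /=.
  rewrite mulr_sumr -big_split; apply: eq_bigr => k _ /=.
  rewrite mulr_sumr -big_split; apply: eq_bigr => l _ /=.
  by rewrite !mxE; ring.
rewrite sum4_exchange rmorph_sum; apply: eq_bigr => i _.
rewrite rmorph_sum; apply: eq_bigr => j _.
rewrite rmorph_sum; apply: eq_bigr => k _.
rewrite rmorph_sum; apply: eq_bigr => l _.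
rewrite !rmorphM /= conjCK -hV.2 -hW.2; ring.
Qed.

Lemma tensor_ip_nondegenerate : 
  nondegenerate_form ipV -> nondegenerate_form ipW ->
  nondegenerate_form (tensor_ip ipV ipW).
Proof.
move=> nV nW Y Y0.
have E a b : ipV a (\sum_k ipW b (\sum_l Y k l *: vbase l) *: vbase k) = 0.
  rewrite (herm_sumr _ _ _ _ hV) -[RHS](Y0 (tens a b)).
  rewrite [in RHS](tensor_base Y) pair_bigA.
  rewrite (herm_sumr (U := tensor V W) _ _ _ _ tensor_ip_hermitian).
  rewrite -(pair_bigA _ (fun k l =>
    Y k l * tensor_ip ipV ipW (tens a b) (tens (vbase k) (vbase l)))) /=.
  apply: eq_bigr => k _; rewrite (herm_sumr _ _ _ _ hW) mulr_suml.
  by apply: eq_bigr => l _; rewrite tensor_ip_tens; ring.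
have fV := basis_free (vbasisP {: V}); have fW := basis_free (vbasisP {: W}).
apply/matrixP => k l; rewrite mxE.
apply: (freeP fW (Y k)) => {l}; apply: nW => b.
exact: (freeP fV (fun k => ipW b (\sum_l Y k l *: vbase l)) (nV _ (E^~ b))).
Qed.

Hypothesis nV : nondegenerate_form ipV.

Lemma adjoint_uniq (g h : 'Hom(W, V)) :
  (forall v w, ipV (g w) v = ipV (h w) v) -> g = h.
Proof.
move=> gh; apply/lfunP => w; apply/eqP; rewrite -subr_eq0; apply/eqP.
apply: nV => v; have [l c] := hV.
by rewrite -scaleN1r addrC l mulN1r [ipV v _]c [ipV v (g w)]c gh addNr.
Qed.

Lemma adjointP (f : 'Hom(V, W)) (v : V) (w : W) :
  ipV (adjoint ipV ipW f w) v = ipW w (f v).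
Proof.
rewrite /adjoint; move: v w.
apply: (xgetPex 0 (P := [set g : 'Hom(W, V) | forall v w,
  ipV (g w) v = ipW w (f v)])).
pose H := \matrix_(i, k) ipV (vbase k) (@vbase V i).
have Hfree : row_free H.
  apply/inj_row_free => u uH; apply/rowP => i; rewrite mxE.
  have fV := basis_free (vbasisP {: V}).
  apply: (freeP fV (u 0)) => {i}; apply: nV => v.
  rewrite (coord_vbasis (memvf v)) (herm_suml _ _ _ _ hV) big1 // => k _.
  move/rowP: uH => /(_ k); rewrite !mxE (herm_sumr _ _ _ _ hV) => uH.
  rewrite (eq_bigr (fun j => u 0 j * H j k)) ?uH ?mulr0 // => j _.
  by rewrite mxE.
pose r w := \row_k ipW (f (@vbase V k)) w.
pose g w := \sum_i (r w *m invmx H) 0 i *: @vbase V i.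
have gl : linear g.
  move=> a x y; rewrite /g scaler_sumr -big_split; apply: eq_bigr => i _ /=.
  have -> : r (a *: x + y) = a *: r x + r y.
    by apply/rowP => k; rewrite !mxE hW.1.
  by rewrite mulmxDl -scalemxAl !mxE scalerDl scalerA.
pose gL := GRing.isSemilinear.Build C W V _ g (GRing.semilinear_linear gl).
pose G : {linear W -> V} := HB.pack g gL.
exists (linfun G) => v w; rewrite lfunE /=.
rewrite (coord_vbasis (memvf v)) linear_sum.
rewrite (herm_sumr _ _ _ _ hV) /=.
under [in RHS]eq_bigr do rewrite linearZ /=.
rewrite (herm_sumr _ _ _ _ hW); apply: eq_bigr => k _; congr (_ * _).
rewrite hV.2 hW.2; congr (_ ^*).
have /rowP/(_ k) : r w *m invmx H *m H = r w.
  by rewrite mulmxKV // -row_free_unit.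
rewrite [RHS]mxE => <-; rewrite mxE (herm_sumr _ _ _ _ hV).
by apply: eq_bigr => i _; rewrite [H _ _]mxE.
Qed.

End AdjointTheory.
End Tensor.

Section FunctionalCalculus.
Variables (C : numClosedFieldType) (A : falgType C).

Definition spectrum (x : A) : set C :=
  [set l | l%:A - x \isn't a GRing.unit].

Lemma spectrum_finite (x : A) : finite_set (spectrum x).
Proof.
pose n := \dim {: A}.
have nfree : ~~ free [tuple x ^+ i | i < n.+1].
  apply/negP; rewrite /free size_tuple => /eqP fX.
  by have := dimvS (subvf <<[tuple x ^+ i | i < n.+1]>>); rewrite fX /= ltnn.
have [k k0 [i ki]] : exists2 k : 'I_n.+1 -> C,
    \sum_(i < n.+1) k i *: x ^+ i = 0 & exists i, k i != 0.
  apply: contrapT => H; move/negP: nfree; apply; apply/freeP => k k0 i.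
  apply/eqP; apply: contra_notT H => ki; exists k; last by exists i.
  by rewrite -[RHS]k0; apply: eq_bigr => j _; rewrite nth_mktuple.
pose p : {poly C} := \poly_(j < n.+1) k (inord j).
have p0 : p != 0.
  apply/eqP => /(congr1 (fun q : {poly C} => q`_i)).
  by rewrite coef_poly coef0 ltn_ord inord_val => /eqP; apply/negP.
have px : horner_alg x p = 0.
  rewrite /p poly_def rmorph_sum -[RHS]k0; apply: eq_bigr => j _ /=.
  by rewrite inord_val linearZ /= rmorphXn /= horner_algX mulr_algl.
have [rs prs] := closed_field_poly_normal p.
apply: (@sub_finite_set _ _ [set` rs]); last exact: finite_seq.
move=> l /= lx.
have : root p l.
  apply: contraNT lx => lp.
  have /factor_theorem[q] : root (p - p.[l]%:P) l.
    by rewrite /root !hornerE subrr.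
  move/(congr1 (horner_alg x)).
  rewrite rmorphB rmorphM rmorphB /= px !horner_algC horner_algX sub0r.
  set y := horner_alg x q => E.
  have comm : y * (x - l%:A) = (x - l%:A) * y.
    have -> : x - l%:A = horner_alg x ('X - l%:P).
      by rewrite rmorphB /= horner_algX horner_algC.
    by rewrite -!rmorphM mulrC.
  apply/unitrP; exists (p.[l]^-1 *: y).
  have E' : y * (l%:A - x) = p.[l]%:A by rewrite -opprB mulrN -E opprK.
  have comm' : (l%:A - x) * y = p.[l]%:A by rewrite -opprB mulNr -comm -E opprK.
  by rewrite -scalerAl -scalerAr E' comm' scalerA mulVf // scale1r.
by rewrite prs rootZ ?lead_coef_eq0 // root_prod_XsubC.
Qed.

(* The Lagrange polynomial taking the value f l at each l of the spectrum.    *)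
Definition interpolant (f : C -> C) (x : A) : {poly C} :=
  let s : seq C := fset_set (spectrum x) in
  \sum_(l <- s) f l *: \prod_(m <- s | m != l) ((l - m)^-1 *: ('X - m%:P)).

Lemma interpolantE (f : C -> C) (x : A) (l : C) :
  spectrum x l -> (interpolant f x).[l] = f l.
Proof.
rewrite -[spectrum x](fset_setK (spectrum_finite x)) /= => lx.
rewrite /interpolant; set s := fset_set _ in lx *.
rewrite horner_sum (bigD1_seq l) ?fset_uniq //= [X in _ + X]big1 => [|m ml].
  rewrite addr0 hornerZ horner_prod big1 ?mulr1 // => m ml.
  by rewrite !hornerE mulVf // subr_eq0 eq_sym.
rewrite hornerZ horner_prod (big_rem l) //= eq_sym ml.
by rewrite !hornerE /= subrr mulr0 mul0r.
Qed.

(* Continuous functional calculus f(x) of a normal x: p(x) for a polynomial p *)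
(* which agrees with f on the finite spectrum of x.                           *)
Definition fcalc (f : C -> C) (x : A) : A := horner_alg x (interpolant f x).

End FunctionalCalculus.

Local Open Scope complex_scope.

(* Finite-dimensional unital C*-algebras over the complex numbers R[i].  The  *)
(* zero algebra is excluded because a falgType is a nonzero ring; the norm is *)
(* automatically complete because the dimension is finite.                    *)
HB.mixin Record isCstarAlgebra (R : realType) M of Falgebra R[i] M := {
  star : M -> M ;
  starK : involutive star ;
  starD : {morph star : x y / x + y} ;
  starZ : forall (c : R[i]) x, star (c *: x) = (c^*)%R *: star x ;
  starM : forall x y, star (x * y) = star y * star x ;
  cstar_norm : M -> R ;
  cstar_normD : forall x y, cstar_norm (x + y) <= cstar_norm x + cstar_norm y ;
  cstar_normZ : forall (c : R[i]) x,
    (cstar_norm (c *: x))%:C = `|c| * (cstar_norm x)%:C ;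
  cstar_norm_eq0 : forall x, cstar_norm x = 0 -> x = 0 ;
  cstar_normM : forall x y, cstar_norm (x * y) <= cstar_norm x * cstar_norm y ;
  cstar_norm_starM : forall x, cstar_norm (star x * x) = cstar_norm x ^+ 2
}.

#[short(type="cstarAlgType")]
HB.structure Definition CstarAlgebra (R : realType) :=
  { M of isCstarAlgebra R M & Falgebra R[i] M }.

Section QuantumGraphs.
Variables (R : realType) (M : cstarAlgType R).

Definition faithful_positive (Psi : {scalar M}) : Prop :=
  (forall a, 0 <= Psi (star a * a)) /\ (forall a, Psi (star a * a) = 0 -> a = 0).

Definition faithful_trace (Tr : {scalar M}) : Prop :=
  faithful_positive Tr /\ (forall a b, Tr (a * b) = Tr (b * a)).

Definition positive_element (x : M) : Prop := exists y, x = star y * y.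

Section L2.
Variable Psi : {scalar M}.

Definition L2_ip (a b : M) : R[i] := Psi (star a * b).

Definition mult : 'Hom(tensor M M, M) := tlift *%R.

Definition mult_adj : 'Hom(M, tensor M M) :=
  adjoint (tensor_ip L2_ip L2_ip) L2_ip mult.

Definition op_adj (A : 'End(M)) : 'End(M) := adjoint L2_ip L2_ip A.

Definition quantum_system (delta : R) : Prop :=
  [/\ faithful_positive Psi, 0 < delta
    & (mult \o mult_adj)%VF = (delta ^+ 2)%:C *: \1%VF].

Definition quantum_graph (delta : R) (A : 'End(M)) : Prop :=
  [/\ quantum_system delta,
      (mult \o tmap A A \o mult_adj)%VF = (delta ^+ 2)%:C *: A,
      forall x, star (A x) = A (star x)
    & forall x, star (op_adj A x) = op_adj A (star x)].

End L2.

Definition cexp (z : R[i]) : R[i] :=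
  (expR (complex.Re z))%:C * (cos (complex.Im z) +i* sin (complex.Im z)).

(* x ^ z for x positive and invertible, so that its spectrum lies in ]0, +oo[ *)
Definition cpow (x : M) (z : R[i]) : M :=
  fcalc (fun l => cexp (z * (ln (complex.Re l))%:C)) x.

Definition density (Psi Tr : {scalar M}) (rho : M) : Prop :=
  [/\ faithful_trace Tr, positive_element rho, rho \is a GRing.unit
    & forall a, Psi a = Tr (rho * a)].

(* sigma_z, for rho a density of Psi; it does not depend on the trace Tr.     *)
Definition modular (rho : M) (z : R[i]) : 'End(M) :=
  (amulr (cpow rho (- ('i * z))) \o amull (cpow rho ('i * z)))%VF.

(* The representation of the opposite algebra of M (with the same underlying  *)
(* vector space as M) on L2(M, Psi).                                          *)
Definition pi_op (rho a : M) : 'End(M) := amulr (modular rho (- ('i / 2)) a).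

Definition KL_fun (rho : M) (delta : R) (A : 'End(M)) (a : M) : 'End(M) :=
  (delta ^- 2)%:C *: ((pi_op rho a \o A)%VF - (A \o pi_op rho a)%VF).

Fact KL_fun_is_linear rho delta A : linear (KL_fun rho delta A).
Proof.
move=> c a b; rewrite /KL_fun /pi_op !linearP /= comp_lfunDl comp_lfunDr.
rewrite -comp_lfunZl -comp_lfunZr scalerA [c * _]mulrC -scalerA -scalerDr.
by congr (_ *: _); rewrite scalerBr opprD addrACA.
Qed.
HB.instance Definition _ rho delta A :=
  GRing.isSemilinear.Build R[i] M 'End(M) _ (KL_fun rho delta A)
    (GRing.semilinear_linear (KL_fun_is_linear rho delta A)).

Definition left_incidence (rho : M) (delta : R) (A : 'End(M)) :
  'Hom(M, 'End(M)) := linfun (KL_fun rho delta A).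

Definition matsuda_incidence (Psi : {scalar M}) (delta : R) (A : 'End(M)) :
    'Hom(M, tensor M M) :=
  (delta ^- 2)%:C *:
    ((tmap (op_adj Psi A) \1 - tmap \1 A) \o mult_adj Psi)%VF.

Definition zeta_fun (Psi : {scalar M}) (T : 'End(M)) : tensor M M :=
  tmap \1%VF T (mult_adj Psi 1).

Fact zeta_fun_is_linear Psi : linear (zeta_fun Psi).
Proof.
move=> c S T; rewrite /zeta_fun; set X := mult_adj Psi 1.
have -> : tmap (\1%VF : 'End(M)) (c *: S + T)
    = c *: tmap (\1%VF : 'End(M)) S + tmap (\1%VF : 'End(M)) T.
  apply: tensor_homP => v w; rewrite add_lfunE scale_lfunE !tmapE.
  by rewrite add_lfunE scale_lfunE (tens_is_bilinear _ _).1.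
by rewrite add_lfunE scale_lfunE.
Qed.
HB.instance Definition _ Psi :=
  GRing.isSemilinear.Build R[i] 'End(M) (tensor M M) _ (zeta_fun Psi)
    (GRing.semilinear_linear (zeta_fun_is_linear Psi)).

(* When Psi is faithful, zeta Psi is bijective and its inverse is            *)
(* ((zeta Psi)^-1)%VF.                                                        *)
Definition zeta (Psi : {scalar M}) : 'Hom('End(M), tensor M M) :=
  linfun (zeta_fun Psi).

End QuantumGraphs.

(* Main.v *)
Require Import Defs.
From HB Require Import structures.
From mathcomp Require Import all_boot all_order all_algebra all_field.
From mathcomp Require Import reals.
From mathcomp Require Import complex.

Set Implicit Arguments.
Unset Strict Implicit.
Unset Printing Implicit Defensive.

Import Order.TTheory GRing.Theory Num.Theory.
Local Open Scope ring_scope.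
Local Open Scope complex_scope.

(** Write [b] for [modular rho (- ('i / 2)) a], so that [pi_op rho a] is right
multiplication by [b].  As the form on the tensor product is nondegenerate, an
element of [tensor M M] is known from its pairings with the pure tensors
[tens c d].  Moving the operators and the comultiplication to the other side of
the pairing, and using that left multiplication by [c] has adjoint left
multiplication by [star c], one finds
  [<tens c d, zeta T> = <d, T (star c)>],
which makes [zeta] injective, and, because [A] commutes with [star],
  [<tens c d, delta^2 nabla_A b> = <A c * d, b> - <c * op_adj A d, b>]
  [                              = <d, A (star c) * b - A (star c * b)>].
The last vector is the commutator of [pi_op rho a] with [A] at [star c], that
is, [delta^2] times the value of [left_incidence a] at [star c].  Hence [zeta]
maps [left_incidence a] to [nabla_A b], and injectivity allows [zeta] to be
inverted.

These two formulas are [L2_ip_tens_zeta] and [L2_ip_tens_matsuda], the second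
one divided by [delta^2]. *)

(** * Pairings with pure tensors *)

Section TensorPairing.
Variables (C : numClosedFieldType) (V W : vectType C).
Variables (ipV : V -> V -> C) (ipW : W -> W -> C).
Hypotheses (hV : hermitian_form ipV) (hW : hermitian_form ipW).

Lemma hermZ (U : vectType C) (ip : U -> U -> C) x k y :
  hermitian_form ip -> ip x (k *: y) = k * ip x y.
Proof.
by move=> h; have := herm_sumr x [:: tt] (fun=> k) (fun=> y) h;
   rewrite !big_seq1.
Qed.

Lemma hermB (U : vectType C) (ip : U -> U -> C) x y z :
  hermitian_form ip -> ip x (y - z) = ip x y - ip x z.
Proof. by move=> h; rewrite -scaleN1r addrC (h.1 x) mulN1r addrC. Qed.

Lemma hermitian_nondegenerate_inj (U : vectType C) (ip : U -> U -> C)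
    (y z : U) : hermitian_form ip -> nondegenerate_form ip ->
  (forall x, ip x y = ip x z) -> y = z.
Proof.
move=> h n yz; apply/eqP; rewrite -subr_eq0; apply/eqP; apply: n => x.
by rewrite hermB // yz subrr.
Qed.

(** Pure tensors span, so they separate points. *)
Lemma tensor_ip_tens_inj (X Y : tensor V W) :
  nondegenerate_form ipV -> nondegenerate_form ipW ->
  (forall v w,
     tensor_ip ipV ipW (tens v w) X = tensor_ip ipV ipW (tens v w) Y) ->
  X = Y.
Proof.
move=> nV nW XY; have h := tensor_ip_hermitian hV hW.
apply: (hermitian_nondegenerate_inj h); first exact: tensor_ip_nondegenerate.
move=> Z; rewrite (tensor_base Z) pair_bigA !(herm_suml _ _ _ _ h) /=.
by apply: eq_bigr => p _; rewrite XY.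
Qed.

(** The adjoint of a tensor product of maps is the tensor product of the
adjoints; [f'] and [g'] are free, so that an operator may also play the
role of the adjoint of its own adjoint. *)
Lemma tensor_ip_tmap (f f' : 'End(V)) (g g' : 'End(W)) v w X :
  (forall x y, ipV (f' x) y = ipV x (f y)) ->
  (forall x y, ipW (g' x) y = ipW x (g y)) ->
  tensor_ip ipV ipW (tens v w) (tmap f g X)
  = tensor_ip ipV ipW (tens (f' v) (g' w)) X.
Proof.
move=> ff' gg'; have h := tensor_ip_hermitian hV hW.
rewrite (tensor_base X) pair_bigA linear_sum /=.
under eq_bigr do rewrite linearZ /= tmapE.
rewrite !(herm_sumr _ _ _ _ h); apply: eq_bigr => p _.
by rewrite !tensor_ip_tens // ff' gg'.
Qed.

End TensorPairing.

(** * The inner product of a faithful positive functional *)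

Section L2Theory.
Variables (R : realType) (M : cstarAlgType R) (Psi : {scalar M}).
Hypothesis hPsi : faithful_positive Psi.
(* On top of [complex_scope], so that [z^*] denotes [Num.conj z]. *)
Local Open Scope ring_scope.

Local Notation ip := (L2_ip Psi).
Local Notation ip2 := (tensor_ip (L2_ip Psi) (L2_ip Psi)).

(** Polarization: [ip (x + k *: y) (x + k *: y)] is nonnegative, hence real, and
this for [k = 1] and [k = 'i] determines [ip y x] from [ip x y]. *)
Lemma L2_ip_hermitian : hermitian_form ip.
Proof.
split=> [x k y z|x y]; first by rewrite /L2_ip mulrDr -scalerAr linearP.
have real_ip (z : M) : (ip z z)^* = ip z z.
  by apply/CrealP/ger0_real; exact: hPsi.1.
have expand (k : R[i]) : ip (x + k *: y) (x + k *: y)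
    = ip x x + (k * ip x y + k^* * ip y x) + k * k^* * ip y y.
  have -> : ip (x + k *: y) (x + k *: y) = Psi (star x * x + k *: (star x * y)
      + (k^* *: (star y * x) + (k * k^*) *: (star y * y))).
    rewrite /L2_ip starD starZ mulrDl !mulrDr; congr (Psi (_ + _ + (_ + _))).
    - by rewrite -scalerAr.
    - by rewrite -scalerAl.
    - by rewrite -scalerAl -scalerAr scalerA mulrC.
  by rewrite !linearD !linearZ /= !addrA.
have cross_real (k : R[i]) :
    (k * ip x y + k^* * ip y x)^* = k * ip x y + k^* * ip y x.
  have := real_ip (x + k *: y); rewrite expand !rmorphD !rmorphM /= !real_ip.
  by rewrite conjCK [k^* * k]mulrC => /addIr /addrI.
set u := ip x y in cross_real *; set v := ip y x in cross_real *.
have := cross_real 1; rewrite rmorph1 !mul1r rmorphD /= => sum_real.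
have := cross_real (Num.imaginary).
rewrite rmorphD !rmorphM /= conjCK conjCi !mulNr addrC -!mulrBr.
move/(mulfI (neq0Ci _)) => diff_real.
have : (u^* + v^*) + (v^* - u^*) = (u + v) + (u - v).
  by rewrite sum_real diff_real.
rewrite [u^* + _]addrC addrACA subrr addr0 addrACA subrr addr0 => E.
have two (z : R[i]) : z + z = 2%:R * z by rewrite mulr_natl mulr2n.
move: E; rewrite !two => /(mulfI _) E.
by rewrite -E ?conjCK // pnatr_eq0.
Qed.

Lemma L2_ip_nondegenerate : nondegenerate_form ip.
Proof. by move=> y /(_ y) /hPsi.2. Qed.

Lemma L2_ip_mull a x y : ip (a * x) y = ip x (star a * y).
Proof. by rewrite /L2_ip starM mulrA. Qed.

Lemma op_adjP (T : 'End(M)) x y : ip (op_adj Psi T x) y = ip x (T y).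
Proof.
exact: (adjointP L2_ip_hermitian L2_ip_hermitian L2_ip_nondegenerate).
Qed.

Lemma multE (x y : M) : mult M (tens x y) = x * y.
Proof.
by apply: tliftE => z k x1 x2; rewrite ?mulrDr ?mulrDl -?scalerAr -?scalerAl.
Qed.

Lemma L2_ip_tens_mult_adj c d b :
  ip2 (tens c d) (mult_adj Psi b) = ip (c * d) b.
Proof.
have h := L2_ip_hermitian; have n := L2_ip_nondegenerate.
have h2 := tensor_ip_hermitian h h.
rewrite h2.2 (adjointP h2 h) ?multE -?h.2 //.
exact: tensor_ip_nondegenerate.
Qed.

(** * The canonical bijection and the Matsuda incidence operator *)

Lemma L2_ip_tens_zeta c d (T : 'End(M)) :
  ip2 (tens c d) (zeta Psi T) = ip d (T (star c)).
Proof.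
have h := L2_ip_hermitian.
rewrite lfunE /= /zeta_fun.
rewrite (tensor_ip_tmap (f' := \1%VF) (g' := op_adj Psi T) h h).
- by rewrite L2_ip_tens_mult_adj id_lfunE L2_ip_mull mulr1 op_adjP.
- by move=> x y; rewrite !id_lfunE.
- exact: op_adjP.
Qed.

Lemma lker_zeta : lker (zeta Psi) == 0%VS.
Proof.
apply/lker0P => S T ST; apply/lfunP => x.
apply: (hermitian_nondegenerate_inj L2_ip_hermitian L2_ip_nondegenerate) => d.
by rewrite -[x]starK -!L2_ip_tens_zeta ST.
Qed.

(** The hypothesis on [A] turns [star (A c)] into [A (star c)], so that both
terms depend on [c] through [star c] only, as in [L2_ip_tens_zeta]. *)
Lemma L2_ip_tens_matsuda (delta : R) (A : 'End(M)) c d b :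
  (forall x, star (A x) = A (star x)) ->
  ip2 (tens c d) (matsuda_incidence Psi delta A b)
  = ip d ((delta ^- 2)%:C *: (A (star c) * b - A (star c * b))).
Proof.
move=> starA; have h := L2_ip_hermitian; have h2 := tensor_ip_hermitian h h.
have id_adj x y : ip ((\1%VF : 'End(M)) x) y = ip x ((\1%VF : 'End(M)) y).
  by rewrite !id_lfunE.
have adjA x y : ip (A x) y = ip x (op_adj Psi A y).
  by rewrite h.2 -op_adjP -h.2.
rewrite scale_lfunE comp_lfunE add_lfunE opp_lfunE.
rewrite (hermZ _ _ _ h2) (hermB _ _ _ h2) (hermZ _ _ _ h) (hermB _ _ _ h).
congr (_ * (_ - _)).
  rewrite (tensor_ip_tmap h h _ _ _ adjA id_adj) L2_ip_tens_mult_adj.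
  by rewrite id_lfunE L2_ip_mull starA.
rewrite (tensor_ip_tmap h h _ _ _ id_adj (op_adjP A)) L2_ip_tens_mult_adj.
by rewrite id_lfunE L2_ip_mull op_adjP.
Qed.

End L2Theory.

Theorem proposition8p5 (R : realType) (M : cstarAlgType R)
    (Psi : {scalar M}) (delta : R) (A : 'End(M))
    (hG : quantum_graph Psi delta A)
    (Tr : {scalar M}) (rho : M) (hrho : density Psi Tr rho) :
  left_incidence rho delta A
  = ((zeta Psi)^-1 \o matsuda_incidence Psi delta A
     \o modular rho (- ('i / 2)))%VF.
Proof.
have [[hPsi _ _] _ starA _] := hG.
have h := L2_ip_hermitian hPsi; have n := L2_ip_nondegenerate hPsi.
apply/lfunP => a.
have pi_opE x : pi_op rho a x = x * modular rho (- ('i / 2)) a.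
  by rewrite lfunE.
rewrite [RHS]comp_lfunE [RHS]comp_lfunE.
move: (modular rho _ a) pi_opE => b pi_opE.
rewrite -[LHS](lker0_lfunK (lker_zeta hPsi)); congr (_ _).
apply: (tensor_ip_tens_inj h h n n) => c d.
rewrite L2_ip_tens_zeta // L2_ip_tens_matsuda //; congr (L2_ip _ _ _).
rewrite [left_incidence _ _ _ _]lfunE /= /KL_fun.
by rewrite scale_lfunE add_lfunE opp_lfunE !comp_lfunE !pi_opE.
Qed.
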